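(* For every $i\in\{1,2,\dots,n\}$ there is an isomorphism of functors $\mathrm{F}_i\cong *\circ\mathrm{G}_i^{\mathrm{op}}\circ *$ (endofunctors of $A\text{-}\mathrm{mod}$).
   Context: $A$ is a finite dimensional associative algebra over an algebraically closed field $\Bbbk$; $A\text{-}\mathrm{mod}$ and $\mathrm{mod}\text{-}A$ are the categories of finitely generated left and right $A$-modules; $*$ denotes both $\Bbbk$-duality functors $\mathrm{Hom}_{\Bbbk}({}_-,\Bbbk)$ between them. $L_1,\dots,L_n$ is a complete irredundant list of simple left $A$-modules; $L_1^*,\dots,L_n^*$ are the simple right $A$-modules; $L_{ij}=L_i\otimes_{\Bbbk}L_j^*$ are the simple $A$-$A$-bimodules. There is a short exact sequence of bimodules $0\to\mathrm{Rad}(A)\to A\to\bigoplus_{i=1}^nL_{ii}\to0$. $J_i$ is the kernel of the induced epimorphism $A\to L_{ii}$, and $\mathrm{F}_i=J_i\otimes_A{}_-:A\text{-}\mathrm{mod}\to A\text{-}\mathrm{mod}$ (the dual projection functor corresponding to $J_i$). For a module $N$, the trace functor $\mathrm{Tr}_N$ sends $M$ to the submodule $\sum_{f:N\to M}\mathrm{Im}(f)\subset M$ and morphisms to their restrictions; the projection functor $\mathrm{Pr}_N$ is the cokernel of the inclusion $\mathrm{Tr}_N\hookrightarrow\mathrm{Id}$. $\mathrm{G}_i$ is the unique (up to isomorphism) left exact endofunctor of $A\text{-}\mathrm{mod}$ whose restriction to the category of finitely generated injective modules is isomorphic to the restriction of $\mathrm{Pr}_{L_i}$. The superscript $\mathrm{op}$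 denotes the corresponding object for the opposite algebra: $\mathrm{G}_i^{\mathrm{op}}$ is the unique left exact endofunctor of $\mathrm{mod}\text{-}A$ which agrees, up to isomorphism, with $\mathrm{Pr}^{\mathrm{op}}_{L_i^*}$ on finitely generated injective right $A$-modules. *)

(* Defs.v *)
From HB Require Import structures.
From mathcomp Require Import all_boot all_algebra all_field.
From mathcomp Require Import boolp functions.
From mathcomp Require Import freeg.

Set Implicit Arguments.
Unset Strict Implicit.
Unset Printing Implicit Defensive.

Import GRing.Theory.
Local Open Scope ring_scope.
Local Open Scope quotient_scope.

(** Left [R]-modules are [lmodType R]; right [R]-modules are left modules over
    the converse ring, [lmodType R^c], so that [(a : R^c) *: x] is [x a]. *)

Definition fin_gen (R : nzRingType) (M : lmodType R) : Prop :=
  exists (n : nat) (e : 'I_n -> M),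
    forall x, exists c : 'I_n -> R, x = \sum_i c i *: e i.

Record fgmod (R : nzRingType) := FgMod {
  fgmod_sort :> lmodType R;
  fgmodP : fin_gen fgmod_sort
}.

Definition mod_iso (R : nzRingType) (M N : lmodType R) : Prop :=
  exists f : {linear M -> N}, bijective f.

Definition simple_module (R : nzRingType) (M : lmodType R) : Prop :=
  (exists x : M, x != 0) /\
  forall S : {pred M}, submod_closed S -> S =i pred1 0 \/ S =i predT.

Definition injective_module (R : nzRingType) (M : lmodType R) : Prop :=
  forall (X Y : lmodType R) (u : {linear X -> Y}) (f : {linear X -> M}),
    injective u -> exists g : {linear Y -> M}, forall x, g (u x) = f x.

(** The Jacobson radical: the elements acting as zero on every simple module. *)
Definition in_jacobson (R : nzRingType) (a : R) : Prop :=
  forall M : lmodType R, simple_module M -> forall x : M, a *: x = 0.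

Lemma fin_gen_surj (R : nzRingType) (M N : lmodType R) (f : {linear M -> N}) :
  (forall y, exists x, f x = y) -> fin_gen M -> fin_gen N.
Proof.
move=> fsurj [n [e eP]]; exists n, (f \o e) => y.
have [x <-] := fsurj y; have [c ->] := eP x.
by exists c; rewrite linear_sum; apply: eq_bigr => i _; rewrite linearZ.
Qed.

Lemma fin_genI (R : nzRingType) (M : lmodType R) (I : finType) (e : I -> M) :
  (forall x, exists c : I -> R, x = \sum_i c i *: e i) -> fin_gen M.
Proof.
move=> eP; exists #|I|, (e \o enum_val) => x; have [c ->] := eP x.
exists (c \o enum_val).
rewrite -[RHS](big_enum_val (A := I) (fun i => c i *: e i)).
by apply: eq_bigl.
Qed.

Lemma linear_ext (R : nzRingType) (M N : lmodType R) (f g : {linear M -> N}) :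
  f =1 g -> f = g.
Proof.
case: f g => f [[fA] [fZ]] [g [[gA] [gZ]]] /= /funext fg; subst g.
congr GRing.Linear.Pack; congr GRing.Linear.Class; congr (_ _);
  exact: Prop_irrelevance.
Qed.

Record functor (R S : nzRingType) := Functor {
  fobj :> fgmod R -> fgmod S;
  fmap : forall M N : fgmod R, {linear M -> N} -> {linear fobj M -> fobj N};
  fmap_id : forall M : fgmod R, fmap (idfun : {linear M -> M}) =1 id;
  fmap_comp : forall (M N P : fgmod R) (f : {linear M -> N})
      (g : {linear N -> P}),
    fmap (g \o f : {linear M -> P}) =1 fmap g \o fmap f
}.
Arguments fmap {R S} F {M N} f : rename.

(** Natural isomorphism between the restrictions of [F] and [G] to the full
    subcategory of the modules satisfying [P]. *)
Definition nat_iso_on (R S : nzRingType) (P : fgmod R -> Prop)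
    (F G : functor R S) : Prop :=
  exists eta : forall M : fgmod R, {linear F M -> G M},
    (forall M : fgmod R, P M -> bijective (eta M)) /\
    (forall (M N : fgmod R) (f : {linear M -> N}), P M -> P N ->
       eta N \o fmap F f =1 fmap G f \o eta M).

Definition nat_iso (R S : nzRingType) (F G : functor R S) : Prop :=
  nat_iso_on (fun=> True) F G.

Definition exact_at (R : nzRingType) (X Y Z : lmodType R)
    (f : {linear X -> Y}) (g : {linear Y -> Z}) : Prop :=
  forall y, g y = 0 <-> exists x, f x = y.

Definition left_exact (R S : nzRingType) (F : functor R S) : Prop :=
  (forall (M N : fgmod R) (f g : {linear M -> N}),
     fmap F (f \+ g : {linear M -> N}) =1 fmap F f \+ fmap F g) /\
  (forall (X Y Z : fgmod R) (f : {linear X -> Y}) (g : {linear Y -> Z}),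
     injective f -> exact_at f g ->
     injective (fmap F f) /\ exact_at (fmap F f) (fmap F g)).

Section QuotientModule.
Variables (R : nzRingType) (M : lmodType R) (S : {pred M}).
Hypothesis S_submod : submod_closed S.

Definition quot_closed : zmodClosed M := HB.pack_for (zmodClosed M) S
  (GRing.isZmodClosed.Build M S (GRing.submod_closedB S_submod)).

Definition quotm : Type := (Quotient.quot quot_closed).
HB.instance Definition _ := GRing.Zmodule.on quotm.

Definition quotm_pi (x : M) : quotm := \pi_(Quotient.quot quot_closed) x.
Definition quotm_repr (x : quotm) : M := repr (x : (Quotient.quot quot_closed)).

Lemma quotm_reprK : cancel quotm_repr quotm_pi.
Proof. by move=> x; rewrite /quotm_pi /quotm_repr reprK. Qed.

Lemma quotm_piE x y : quotm_pi x = quotm_pi y <-> x - y \in S.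
Proof.
split; first by move=> /eqP; rewrite -Quotient.idealrBE.
by move=> Sxy; apply/eqP; rewrite -Quotient.idealrBE.
Qed.

Lemma quotm_piB : zmod_morphism quotm_pi.
Proof. by move=> x y; rewrite /quotm_pi raddfB. Qed.

Definition quotm_scale (a : R) (x : quotm) : quotm := quotm_pi (a *: quotm_repr x).

Lemma quotm_pi_scale a x : quotm_pi (a *: x) = quotm_scale a (quotm_pi x).
Proof.
apply/quotm_piE; rewrite -scalerBr.
apply: (GRing.submod_closed_semi S_submod).2; apply/quotm_piE.
by rewrite quotm_reprK.
Qed.

HB.instance Definition _ := GRing.isZmodMorphism.Build M quotm quotm_pi quotm_piB.

Fact quotm_scaleA a b x :
  quotm_scale a (quotm_scale b x) = quotm_scale (a * b) x.
Proof. by rewrite -[x]quotm_reprK -!quotm_pi_scale scalerA. Qed.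
Fact quotm_scale1 : left_id 1 quotm_scale.
Proof. by move=> x; rewrite -[x]quotm_reprK -!quotm_pi_scale scale1r. Qed.
Fact quotm_scaleDr : right_distributive quotm_scale +%R.
Proof.
move=> a x y; rewrite -[x]quotm_reprK -[y]quotm_reprK.
by rewrite -raddfD -!quotm_pi_scale scalerDr raddfD.
Qed.
Fact quotm_scaleDl x : {morph quotm_scale^~ x : a b / a + b}.
Proof.
by move=> a b; rewrite -[x]quotm_reprK -!quotm_pi_scale scalerDl raddfD.
Qed.
HB.instance Definition _ := GRing.Zmodule_isLmodule.Build R quotm
  quotm_scaleA quotm_scale1 quotm_scaleDr quotm_scaleDl.

Lemma quotm_piZ : scalable quotm_pi.
Proof. exact: quotm_pi_scale. Qed.
HB.instance Definition _ :=
  GRing.isScalable.Build R M quotm _ quotm_pi quotm_piZ.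

Lemma quotm_fin_gen : fin_gen M -> fin_gen quotm.
Proof.
apply: (@fin_gen_surj _ _ _ quotm_pi) => y.
by exists (quotm_repr y); exact: quotm_reprK.
Qed.

End QuotientModule.

Section QuotientMap.
Variables (R : nzRingType) (M N : lmodType R) (S : {pred M}) (T : {pred N}).
Hypotheses (S_submod : submod_closed S) (T_submod : submod_closed T).
Variable f : {linear M -> N}.
Hypothesis fST : forall x, x \in S -> f x \in T.

Definition quotm_map_fun of (forall x, x \in S -> f x \in T) :=
  fun x : quotm S_submod => quotm_pi T_submod (f (quotm_repr x)).

Lemma quotm_map_funE x :
  quotm_map_fun fST (quotm_pi S_submod x) = quotm_pi T_submod (f x).
Proof.
apply/quotm_piE; rewrite -raddfB; apply/fST/(quotm_piE S_submod).
exact: quotm_reprK.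
Qed.

Fact quotm_map_linear : linear (quotm_map_fun fST).
Proof.
move=> a x y; rewrite -[x]quotm_reprK -[y]quotm_reprK.
by rewrite -linearP !quotm_map_funE !linearP.
Qed.
HB.instance Definition _ := GRing.isLinear.Build R (quotm S_submod)
  (quotm T_submod) _ (quotm_map_fun fST) quotm_map_linear.

Definition quotm_map : {linear quotm S_submod -> quotm T_submod} :=
  quotm_map_fun fST.

End QuotientMap.

Section Trace.
Variables (R : nzRingType) (N : lmodType R).

Definition in_trace (M : lmodType R) (x : M) : Prop :=
  exists (n : nat) (f : 'I_n -> {linear N -> M}) (y : 'I_n -> N),
    x = \sum_i f i (y i).

(** The sum of the images of all the homomorphisms [N -> M]. *)
Definition trace (M : lmodType R) : {pred M} := fun x => `[< in_trace x >].
Arguments trace : clear implicits.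

Lemma trace_submod_closed (M : lmodType R) : submod_closed (trace M).
Proof.
split; first by apply/asboolP; exists 0%N, (fun=> \0), (fun=> 0); rewrite big_ord0.
move=> a u v /asboolP[n [f [y ->]]] /asboolP[m [g [z ->]]]; apply/asboolP.
exists (n + m)%N, (fun i => match fintype.split i with inl j => f j | inr j => g j end).
exists (fun i => match fintype.split i with inl j => a *: y j | inr j => z j end).
rewrite big_split_ord /= scaler_sumr; congr (_ + _); apply: eq_bigr => i _.
  by rewrite (unsplitK (inl i)) linearZ.
by rewrite (unsplitK (inr i)).
Qed.

Lemma trace_map (M M' : lmodType R) (f : {linear M -> M'}) x :
  x \in trace M -> f x \in trace M'.
Proof.
move=> /asboolP[n [g [y ->]]]; apply/asboolP.
by exists n, (fun i => f \o g i), y; rewrite linear_sum.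
Qed.

Definition proj_obj (M : fgmod R) : fgmod R :=
  FgMod (quotm_fin_gen (trace_submod_closed M) (fgmodP M)).

Definition proj_map (M M' : fgmod R) (f : {linear M -> M'}) :
    {linear proj_obj M -> proj_obj M'} :=
  quotm_map (trace_submod_closed M) (trace_submod_closed M') (@trace_map _ _ f).

Fact proj_map_id (M : fgmod R) : proj_map (idfun : {linear M -> M}) =1 id.
Proof. by move=> x; rewrite -[x]quotm_reprK [LHS]quotm_map_funE. Qed.
Fact proj_map_comp (M1 M2 M3 : fgmod R)
    (f : {linear M1 -> M2}) (g : {linear M2 -> M3}) :
  proj_map (g \o f : {linear M1 -> M3}) =1 proj_map g \o proj_map f.
Proof.
move=> x; rewrite -[x]quotm_reprK.
by rewrite [LHS]quotm_map_funE /= /proj_map !quotm_map_funE.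
Qed.

(** The cokernel of the inclusion of the trace functor of [N] into the identity
    functor. *)
Definition proj_functor : functor R R := Functor proj_map_id proj_map_comp.

End Trace.

HB.mixin Record Lmodule_isBimodule (R S : nzRingType) V of GRing.Lmodule R V := {
  ract : V -> S -> V;
  ractDl : forall s, {morph ract^~ s : x y / x + y};
  ractDr : forall x, {morph ract x : s t / s + t};
  ract1 : forall x, ract x 1 = x;
  ractA : forall x s t, ract (ract x s) t = ract x (s * t);
  ractZl : forall a x s, ract (a *: x) s = a *: ract x s
}.
#[short(type="bimodType")]
HB.structure Definition Bimodule (R S : nzRingType) :=
  {V of GRing.Lmodule R V & Lmodule_isBimodule R S V}.

Lemma ract0 (R S : nzRingType) (V : bimodType R S) (s : S) : ract (0 : V) s = 0.
Proof. by apply: (@addIr _ (ract (0 : V) s)); rewrite -ractDl !add0r. Qed.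

Record bimod_hom (R S : nzRingType) (N N' : bimodType R S) := BimodHom {
  bimod_fun :> {linear N -> N'};
  bimod_funP : forall x (s : S), bimod_fun (ract x s) = ract (bimod_fun x) s
}.

Section RegularBimodule.
Variable R : nzRingType.
HB.instance Definition _ := Lmodule_isBimodule.Build R R R^o
  (fun s x y => mulrDl x y s) (fun x s t => mulrDr x s t) (@mulr1 R)
  (fun x s t => esym (mulrA x s t)) (fun a x s => esym (mulrA a x s)).
End RegularBimodule.

Section BimoduleKernel.
Variables (R S : nzRingType) (N N' : bimodType R S) (f : bimod_hom N N').

Definition bker_pred : pred N := fun x => f x == 0.

Fact bker_pred_submod : GRing.subsemimod_closed bker_pred.
Proof.
apply: GRing.submod_closed_semi; split; first by apply/eqP; exact: linear0.
move=> a x y /eqP fx0 /eqP fy0; apply/eqP.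
by rewrite linearP fx0 fy0 scaler0 addr0.
Qed.
HB.instance Definition _ :=
  GRing.isSubmodClosed.Build R N bker_pred bker_pred_submod.

Definition bker : Type := {x | bker_pred x}.
HB.instance Definition _ := SubChoice.on bker.
HB.instance Definition _ := [SubChoice_isSubLmodule of bker by <:].

Fact bker_ract_subproof (x : bker) (s : S) : bker_pred (ract (val x) s).
Proof.
have fx0 : f (val x) = 0 by apply/eqP; exact: valP x.
by apply/eqP; rewrite bimod_funP fx0 ract0.
Qed.
Definition bker_ract (x : bker) (s : S) : bker := Sub _ (bker_ract_subproof x s).

Fact bker_ractDl s : {morph bker_ract^~ s : x y / x + y}.
Proof. by move=> x y; apply: val_inj; rewrite /= ractDl. Qed.
Fact bker_ractDr x : {morph bker_ract x : s t / s + t}.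
Proof. by move=> s t; apply: val_inj; rewrite /= ractDr. Qed.
Fact bker_ract1 x : bker_ract x 1 = x.
Proof. by apply: val_inj; rewrite /= ract1. Qed.
Fact bker_ractA x s t : bker_ract (bker_ract x s) t = bker_ract x (s * t).
Proof. by apply: val_inj; rewrite /= ractA. Qed.
Fact bker_ractZl a x s : bker_ract (a *: x) s = a *: bker_ract x s.
Proof. by apply: val_inj; rewrite /= ractZl. Qed.
HB.instance Definition _ := Lmodule_isBimodule.Build R S bker
  bker_ractDl bker_ractDr bker_ract1 bker_ractA bker_ractZl.

End BimoduleKernel.

Section Tensor.
Variables (R S : nzRingType) (N : bimodType R S) (M : lmodType S).

Local Notation gen x m := (<< (x, m) >> : {freeg (N * M)%type / int}).

(** The subgroup of the free abelian group on [N * M] generated by the relations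
    of biadditivity and balancedness. *)
Inductive tensor_rel : {freeg (N * M)%type / int} -> Prop :=
| TensorRel0 : tensor_rel 0
| TensorRelB u v : tensor_rel u -> tensor_rel v -> tensor_rel (u - v)
| TensorRelDl x y m : tensor_rel (gen (x + y) m - gen x m - gen y m)
| TensorRelDr x m m' : tensor_rel (gen x (m + m') - gen x m - gen x m')
| TensorRelBal x (s : S) m : tensor_rel (gen (ract x s) m - gen x (s *: m)).

Definition tensor_pred : pred {freeg (N * M)%type / int} :=
  fun u => `[< tensor_rel u >].

Fact tensor_pred_closed : zmod_closed tensor_pred.
Proof.
split; first by apply/asboolP; exact: TensorRel0.
by move=> u v /asboolP ru /asboolP rv; apply/asboolP; exact: TensorRelB.
Qed.
Definition tensor_zmod : zmodClosed {freeg (N * M)%type / int} :=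
  HB.pack_for (zmodClosed {freeg (N * M)%type / int}) tensor_pred
    (GRing.isZmodClosed.Build _ tensor_pred tensor_pred_closed).

Definition tensor : Type := Quotient.quot tensor_zmod.
HB.instance Definition _ := GRing.Zmodule.on tensor.

Definition tensor_pi (u : {freeg (N * M)%type / int}) : tensor :=
  \pi_(Quotient.quot tensor_zmod) u.
Definition tensor_repr (t : tensor) : {freeg (N * M)%type / int} :=
  repr (t : Quotient.quot tensor_zmod).

Definition tens (x : N) (m : M) : tensor := tensor_pi (gen x m).

Lemma tensor_reprK : cancel tensor_repr tensor_pi.
Proof. by move=> t; rewrite /tensor_pi /tensor_repr reprK. Qed.

Lemma tensor_piE u v : tensor_pi u = tensor_pi v <-> tensor_rel (u - v).
Proof.
split; first by move=> /eqP; rewrite -Quotient.idealrBE => /asboolP.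
by move=> /asboolP ruv; apply/eqP; rewrite -Quotient.idealrBE.
Qed.

Fact tensor_piB : zmod_morphism tensor_pi.
Proof. by move=> u v; rewrite /tensor_pi raddfB. Qed.
HB.instance Definition _ :=
  GRing.isZmodMorphism.Build {freeg (N * M)%type / int} tensor tensor_pi
    tensor_piB.

Lemma tensDl x y m : tens (x + y) m = tens x m + tens y m.
Proof.
rewrite /tens -raddfD; apply/tensor_piE; rewrite opprD addrA.
exact: TensorRelDl.
Qed.

Lemma tensDr x m m' : tens x (m + m') = tens x m + tens x m'.
Proof.
rewrite /tens -raddfD; apply/tensor_piE; rewrite opprD addrA.
exact: TensorRelDr.
Qed.

Lemma tens0l m : tens 0 m = 0.
Proof. by apply: (@addIr _ (tens 0 m)); rewrite -tensDl !add0r. Qed.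

Lemma tens0r x : tens x 0 = 0.
Proof. by apply: (@addIr _ (tens x 0)); rewrite -tensDr !add0r. Qed.

Lemma tens_suml n (x : 'I_n -> N) m :
  tens (\sum_i x i) m = \sum_i tens (x i) m.
Proof. exact: (big_morph (tens^~ m) (fun x y => tensDl x y m) (tens0l m)). Qed.

Lemma tens_sumr n x (m : 'I_n -> M) :
  tens x (\sum_i m i) = \sum_i tens x (m i).
Proof. exact: (big_morph (tens x) (tensDr x) (tens0r x)). Qed.

Lemma tens_bal x (s : S) m : tens (ract x s) m = tens x (s *: m).
Proof. by apply/tensor_piE; exact: TensorRelBal. Qed.

Section Lift.
Variables (Z : zmodType) (phi : N -> M -> Z).

Definition balanced : Prop :=
  [/\ forall m, {morph phi^~ m : x y / x + y},
      forall x, {morph phi x : m m' / m + m'}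
    & forall x (s : S) m, phi (ract x s) m = phi x (s *: m)].

Hypothesis phi_bal : balanced.

Let lift (u : {freeg (N * M)%type / int}) : Z :=
  fglift (fun xm => phi xm.1 xm.2 : zmodule Z) u.

Let lift_gen x m : lift (gen x m) = phi x m.
Proof. by rewrite /lift liftU scale1r. Qed.

Let liftB : zmod_morphism lift.
Proof.
exact: (lift_is_additive (fun xm => phi xm.1 xm.2 : zmodule Z)).
Qed.

Let lift_rel u : tensor_rel u -> lift u = 0.
Proof.
case: phi_bal => phiDl phiDr phiB.
elim=> [|{}u v _ lu0 _ lv0|x y m|x m m'|x s m].
- by have := liftB 0 0; rewrite !subrr.
- by rewrite liftB lu0 lv0 subr0.
- by rewrite !liftB !lift_gen phiDl -addrA -opprD subrr.
- by rewrite !liftB !lift_gen phiDr -addrA -opprD subrr.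
- by rewrite liftB !lift_gen phiB subrr.
Qed.

Definition tensor_lift of balanced : tensor -> Z := fun t => lift (tensor_repr t).

Let tensor_lift_pi u : tensor_lift phi_bal (tensor_pi u) = lift u.
Proof.
by apply/subr0_eq; rewrite -liftB; apply/lift_rel/tensor_piE/tensor_reprK.
Qed.

Lemma tensor_liftE x m : tensor_lift phi_bal (tens x m) = phi x m.
Proof. by rewrite tensor_lift_pi lift_gen. Qed.

Fact tensor_lift_is_additive : zmod_morphism (tensor_lift phi_bal).
Proof.
move=> t u; rewrite -[t]tensor_reprK -[u]tensor_reprK -raddfB !tensor_lift_pi.
exact: liftB.
Qed.
HB.instance Definition _ := GRing.isZmodMorphism.Build tensor Z
  (tensor_lift phi_bal) tensor_lift_is_additive.

End Lift.

Lemma tensor_ind (P : tensor -> Prop) :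
  P 0 -> (forall t u, P t -> P u -> P (t - u)) -> (forall x m, P (tens x m)) ->
  forall t, P t.
Proof.
move=> P0 PB Ptens t; rewrite -[t]tensor_reprK -[tensor_repr t]freeg_sumE.
have PN u : P u -> P (- u) by move=> Pu; rewrite -sub0r; apply: PB.
have PD u v : P u -> P v -> P (u + v).
  by move=> Pu Pv; rewrite -[v]opprK; apply: PB => //; apply: PN.
have PM u k : P u -> P (u *+ k).
  by move=> Pu; elim: k => // k IHk; rewrite mulrS; apply: PD.
rewrite raddf_sum; elim/big_ind: _ => //= -[x m] _; set c := coeff _ _.
have -> : << c *g (x, m) >> = gen x m *~ c by rewrite freegU_mulz intz.
rewrite raddfMz; case: c => k; last apply: PN; apply: PM; exact: Ptens.
Qed.

Lemma tensor_ext (Z : zmodType) (f g : {additive tensor -> Z}) :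
  (forall x m, f (tens x m) = g (tens x m)) -> f =1 g.
Proof.
move=> fg; elim/tensor_ind => [|t u ft fu|]; last exact: fg.
  by rewrite !raddf0.
by rewrite !raddfB ft fu.
Qed.

End Tensor.

Section TensorMap.
Variables (R S : nzRingType) (N N' : bimodType R S) (M M' : lmodType S).
Variables (f : {additive N -> N'}) (g : {linear M -> M'}).
Hypothesis f_ract : forall x (s : S), f (ract x s) = ract (f x) s.

Fact tensor_map_balanced : balanced (fun x m => tens (f x) (g m)).
Proof.
split=> [m x y|x m m'|x s m]; first by rewrite raddfD tensDl.
  by rewrite linearD tensDr.
by rewrite f_ract linearZ tens_bal.
Qed.

Definition tensor_map : tensor N M -> tensor N' M' :=
  tensor_lift tensor_map_balanced.
HB.instance Definition _ := GRing.Additive.on tensor_map.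

Lemma tensor_mapE x m : tensor_map (tens x m) = tens (f x) (g m).
Proof. exact: tensor_liftE. Qed.

End TensorMap.

Section TensorModule.
Variables (R S : nzRingType) (N : bimodType R S) (M : lmodType S).
Implicit Types (a b : R) (t u : tensor N M).

Fact tensor_scale_subproof a (x : N) (s : S) :
  a *: ract x s = ract (a *: x) s.
Proof. by rewrite ractZl. Qed.

Definition tensor_scale a : tensor N M -> tensor N M :=
  tensor_map (f := *:%R a) idfun (tensor_scale_subproof a).
HB.instance Definition _ a := GRing.Additive.on (tensor_scale a).

Lemma tensor_scaleE a x m : tensor_scale a (tens x m) = tens (a *: x) m.
Proof. exact: tensor_mapE. Qed.

Fact tensor_scaleA a b t :
  tensor_scale a (tensor_scale b t) = tensor_scale (a * b) t.
Proof.
apply: (tensor_ext (f := tensor_scale a \o tensor_scale b)) => x m /=.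
by rewrite !tensor_scaleE scalerA.
Qed.
Fact tensor_scale1 : left_id 1 tensor_scale.
Proof.
move=> t; apply: (tensor_ext (g := idfun)) => x m.
by rewrite [LHS]tensor_scaleE scale1r.
Qed.
Fact tensor_scaleDr : right_distributive tensor_scale +%R.
Proof. by move=> a t u; rewrite raddfD. Qed.
Fact tensor_scaleDl t : {morph tensor_scale^~ t : a b / a + b}.
Proof.
move=> a b.
apply: (tensor_ext (g := tensor_scale a \+ tensor_scale b)) => x m /=.
by rewrite [LHS]tensor_scaleE !tensor_scaleE scalerDl tensDl.
Qed.
HB.instance Definition _ := GRing.Zmodule_isLmodule.Build R (tensor N M)
  tensor_scaleA tensor_scale1 tensor_scaleDr tensor_scaleDl.

Lemma tensZl a x m : a *: tens x m = tens (a *: x) m :> tensor N M.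
Proof. exact: tensor_scaleE. Qed.

Lemma tensor_fin_gen :
  fin_gen (N : lmodType R) -> fin_gen M -> fin_gen (tensor N M).
Proof.
move=> [n [e eP]] [m [h hP]].
suff gP t : exists c : 'I_n * 'I_m -> R,
    t = \sum_p c p *: tens (e p.1) (h p.2) by exact: fin_genI gP.
elim/tensor_ind: t => [|t u [c ->] [d ->]|x y].
- by exists (fun=> 0); rewrite big1 // => p _; rewrite scale0r.
- exists (fun p => c p - d p); rewrite -sumrB; apply: eq_bigr => p _.
  by rewrite scalerBl.
have [s ->] := hP y.
have /fin_all_exists[a aP] l : exists a : 'I_n -> R,
  ract x (s l) = \sum_i a i *: e i by apply: eP.
exists (fun p => a p.2 p.1).
rewrite -(pair_bigA _ (fun i l => a l i *: tens (e i) (h l))) exchange_big /=.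
rewrite tens_sumr; apply: eq_bigr => l _; rewrite -tens_bal aP tens_suml.
by apply: eq_bigr => i _; rewrite tensZl.
Qed.

End TensorModule.

Section TensorBimodule.
Variables (R S T : nzRingType) (N : bimodType R S) (M : bimodType S T).
Implicit Types (c d : T) (t u : tensor N M).

Definition ract_by c : M -> M := fun m => ract m c.
Fact ract_by_linear c : linear (ract_by c).
Proof. by move=> s m m'; rewrite /ract_by ractDl ractZl. Qed.
HB.instance Definition _ c :=
  GRing.isLinear.Build S M M _ (ract_by c) (ract_by_linear c).

Fact tensor_ract_subproof (x : N) (s : S) : idfun (ract x s) = ract (idfun x) s.
Proof. by []. Qed.

Definition tensor_ract t c : tensor N M :=
  tensor_map (f := idfun) (ract_by c) tensor_ract_subproof t.

Lemma tensor_ractE x m c : tensor_ract (tens x m) c = tens x (ract m c).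
Proof. exact: tensor_mapE. Qed.

Fact tensor_ractB c : zmod_morphism (tensor_ract^~ c).
Proof. by move=> t u; rewrite /tensor_ract raddfB. Qed.

Fact tensor_ractDl c : {morph tensor_ract^~ c : t u / t + u}.
Proof. by move=> t u; rewrite /tensor_ract raddfD. Qed.
Fact tensor_ractDr t : {morph tensor_ract t : c d / c + d}.
Proof.
move=> c d; elim/tensor_ind: t => [|t u ft fu|x m].
- by rewrite /tensor_ract !raddf0 addr0.
- by rewrite !tensor_ractB ft fu opprD addrACA.
- by rewrite !tensor_ractE ractDr tensDr.
Qed.
Fact tensor_ract1 t : tensor_ract t 1 = t.
Proof.
elim/tensor_ind: t => [|t u ft fu|x m]; first by rewrite /tensor_ract raddf0.
  by rewrite tensor_ractB ft fu.
by rewrite tensor_ractE ract1.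
Qed.
Fact tensor_ractA t c d :
  tensor_ract (tensor_ract t c) d = tensor_ract t (c * d).
Proof.
elim/tensor_ind: t => [|t u ft fu|x m]; first by rewrite /tensor_ract !raddf0.
  by rewrite !tensor_ractB ft fu.
by rewrite !tensor_ractE ractA.
Qed.
Fact tensor_ractZl a t c : tensor_ract (a *: t) c = a *: tensor_ract t c.
Proof.
elim/tensor_ind: t => [|t u ft fu|x m].
- by rewrite scaler0 /tensor_ract raddf0 scaler0.
- by rewrite scalerBr !tensor_ractB scalerBr ft fu.
- by rewrite tensZl !tensor_ractE tensZl.
Qed.
HB.instance Definition _ := Lmodule_isBimodule.Build R T (tensor N M)
  tensor_ractDl tensor_ractDr tensor_ract1 tensor_ractA tensor_ractZl.

End TensorBimodule.

Section TensorFunctor.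
Variables (R S : nzRingType) (N : bimodType R S).
Hypothesis N_fin_gen : fin_gen (N : lmodType R).

Section Map.
Variables (M M' : lmodType S) (f : {linear M -> M'}).

Definition tensorl_map_fun : tensor N M -> tensor N M' :=
  tensor_map (f := idfun) f (fun (x : N) (s : S) => erefl (ract x s)).
HB.instance Definition _ := GRing.Additive.on tensorl_map_fun.

Lemma tensorl_map_funE x m : tensorl_map_fun (tens x m) = tens x (f m).
Proof. exact: tensor_mapE. Qed.

Fact tensorl_map_scalable : scalable tensorl_map_fun.
Proof.
move=> a t; elim/tensor_ind: t => [|t u ft fu|x m].
- by rewrite scaler0 raddf0 scaler0.
- by rewrite scalerBr !raddfB /= ft fu.
- by rewrite tensZl !tensorl_map_funE tensZl.
Qed.
HB.instance Definition _ := GRing.isScalable.Build R (tensor N M)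
  (tensor N M') _ tensorl_map_fun tensorl_map_scalable.

End Map.

Definition tensorl_obj (M : fgmod S) : fgmod R :=
  FgMod (tensor_fin_gen N_fin_gen (fgmodP M)).

Definition tensorl_map (M M' : fgmod S) (f : {linear M -> M'}) :
    {linear tensorl_obj M -> tensorl_obj M'} :=
  tensorl_map_fun f.

Fact tensorl_map_id (M : fgmod S) : tensorl_map (idfun : {linear M -> M}) =1 id.
Proof.
apply: (tensor_ext (g := idfun)) => x m; exact: tensorl_map_funE.
Qed.
Fact tensorl_map_comp (M1 M2 M3 : fgmod S)
    (f : {linear M1 -> M2}) (g : {linear M2 -> M3}) :
  tensorl_map (g \o f : {linear M1 -> M3}) =1 tensorl_map g \o tensorl_map f.
Proof.
apply: (tensor_ext (g := tensorl_map g \o tensorl_map f)) => x m.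
by rewrite [LHS]tensorl_map_funE /= !tensorl_map_funE.
Qed.

Definition tensor_functor : functor S R :=
  Functor tensorl_map_id tensorl_map_comp.

End TensorFunctor.

Section ConverseAlgebra.
Variables (k : fieldType) (A : falgType k).
HB.instance Definition _ := GRing.Lmodule.on A^c.
HB.instance Definition _ := GRing.Lmodule_isLalgebra.Build k A^c
  (fun c x y => @scalerAr k A c y x).
HB.instance Definition _ := GRing.Lalgebra_isAlgebra.Build k A^c
  (fun c x y => @scalerAl k A c y x).
HB.instance Definition _ := Vector.on A^c.
End ConverseAlgebra.

(** Used with [iota c = c%:A], for modules over both [A] and [A^c]. *)
Lemma fin_gen_inj (k : fieldType) (W : vectType k) (R : nzRingType)
    (U : lmodType R) (iota : k -> R) (phi : {additive U -> W}) :
  (forall c u, phi (iota c *: u) = c *: phi u) -> injective phi -> fin_gen U.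
Proof.
move=> phiZ phiI.
have [s sP] : exists s : seq U, forall u, phi u \in <<map phi s>>%VS.
  apply: contrapT => nos.
  have big d : exists s : seq U, (d <= \dim <<map phi s>>)%N.
    elim: d => [|d [s ds]]; first by exists [::].
    have [u uP] : exists u, phi u \notin <<map phi s>>%VS.
      apply: contrapT => nou; apply: nos; exists s => u.
      by apply: contrapT => /negP nu; apply: nou; exists u.
    exists (u :: s) => /=; apply: leq_ltn_trans ds _.
    rewrite ltnNge; apply: contra uP => le_dim.
    rewrite span_cons in le_dim.
    have /eqP -> : (<<map phi s>> == <[phi u]> + <<map phi s>>)%VS.
      by rewrite eqEdim addvSr.
    exact: subvP (addvSl _ _) _ (memv_line _).
  have [s] := big (\dim {:W}).+1.
  by rewrite ltnNge dimvS ?subvf.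
exists (size s), (fun i => s`_i) => u.
have := coord_span (X := map_tuple phi (in_tuple s)) (sP u).
set c := coord _ => uE; exists (fun i => iota (c i (phi u))).
apply: phiI; rewrite raddf_sum {1}uE; apply: eq_bigr => i _.
by rewrite phiZ (nth_map 0).
Qed.

Section Dual.
Variables (k : fieldType) (B : falgType k) (M : lmodType B).

Definition kform_pred : pred (M -> k^o) := fun f =>
  `[< (forall x y, f (x + y) = f x + f y) /\
      (forall c x, f (c%:A *: x) = c * f x) >].

Fact kform_zmod_closed : zmod_closed kform_pred.
Proof.
split.
  apply/asboolP; split=> [x y|c x]; first exact: (esym (addr0 0)).
  exact: (esym (mulr0 c)).
move=> f g /asboolP[fD fZ] /asboolP[gD gZ]; apply/asboolP.
have fgE x : (f - g) x = f x - g x by [].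
split=> [x y|c x]; rewrite !fgE; first by rewrite fD gD opprD addrACA.
by rewrite fZ gZ mulrBr.
Qed.
HB.instance Definition _ :=
  GRing.isZmodClosed.Build (M -> k^o) kform_pred kform_zmod_closed.

Definition dual : Type := {f | kform_pred f}.
HB.instance Definition _ := SubChoice.on dual.
HB.instance Definition _ := [SubChoice_isSubZmodule of dual by <:].

Definition dual_fun (f : dual) : M -> k := val f.
Coercion dual_fun : dual >-> Funclass.

Lemma dualP (f g : dual) : f =1 g -> f = g.
Proof. by move=> fg; apply/val_inj/funext. Qed.
Lemma dual_funD (f : dual) x y : f (x + y) = f x + f y.
Proof. by have /asboolP[+ _] := valP f. Qed.
Lemma dual_funZ (f : dual) c x : f (c%:A *: x) = c * f x.
Proof. by have /asboolP[_ +] := valP f. Qed.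
Lemma dual_funB (f : dual) x y : f (x - y) = f x - f y.
Proof. by apply: (@addIr _ (f y)); rewrite -dual_funD !subrK. Qed.

Lemma dual_funZl (f : dual) c (b : B) x : f ((c *: b) *: x) = c * f (b *: x).
Proof. by rewrite -[c *: b]mulr_algl -scalerA dual_funZ. Qed.
Lemma dual_fun0 (f : dual) : f 0 = 0.
Proof. by rewrite -(subrr 0) dual_funB subrr. Qed.
Lemma dual_fun_sum (f : dual) n (x : 'I_n -> M) :
  f (\sum_i x i) = \sum_i f (x i).
Proof. exact: (big_morph f (dual_funD f) (dual_fun0 f)). Qed.

Fact dual_act_subproof (b : B) (f : dual) : kform_pred (fun x => f (b *: x)).
Proof.
apply/asboolP; split=> [x y|c x]; first by rewrite scalerDr dual_funD.
by rewrite scalerA mulr_algr -mulr_algl -scalerA dual_funZ.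
Qed.
Definition dual_act (b : B) (f : dual) : dual := Sub _ (dual_act_subproof b f).


Lemma dual_actE b f x : dual_act b f x = f (b *: x).
Proof. by []. Qed.

Fact dual_actDr b : {morph dual_act b : f g / f + g}.
Proof. by move=> f g; apply: dualP. Qed.
Fact dual_actDl f : {morph dual_act^~ f : a b / a + b}.
Proof.
by move=> a b; apply: dualP => x; rewrite !dual_actE scalerDl dual_funD.
Qed.
Fact dual_act1 : left_id 1 dual_act.
Proof. by move=> f; apply: dualP => x; rewrite dual_actE scale1r. Qed.
Fact dual_actA a b f : dual_act a (dual_act b f) = dual_act (b * a) f.
Proof. by apply: dualP => x; rewrite !dual_actE scalerA. Qed.

End Dual.

Section DualMap.
Variables (k : fieldType) (B : falgType k) (M N : lmodType B).
Variable f : {linear M -> N}.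

Fact dual_map_subproof (g : dual N) : kform_pred (fun x => g (f x)).
Proof.
apply/asboolP; split=> [x y|c x]; first by rewrite linearD dual_funD.
by rewrite linearZ dual_funZ.
Qed.
Definition dual_map (g : dual N) : dual M := Sub _ (dual_map_subproof g).

Lemma dual_mapE g x : dual_map g x = g (f x).
Proof. by []. Qed.
Fact dual_mapB : zmod_morphism dual_map.
Proof. by move=> g h; apply: dualP. Qed.
Fact dual_mapZ b g : dual_map (dual_act b g) = dual_act b (dual_map g).
Proof. by apply: dualP => x; rewrite !(dual_mapE, dual_actE) linearZ. Qed.
End DualMap.

Section DualMatrix.
Variables (k : fieldType) (B : falgType k) (M : lmodType B).
Variables (n : nat) (e : 'I_n -> M).

Definition dual_mx (f : dual M) : 'M[k]_(n, \dim {:B}) :=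
  \matrix_(i, j) f ((vbasis {:B})`_j *: e i).

Fact dual_mx_additive : zmod_morphism dual_mx.
Proof. by move=> f g; apply/matrixP=> i j; rewrite !mxE. Qed.
HB.instance Definition _ := GRing.isZmodMorphism.Build (dual M)
  'M[k]_(n, \dim {:B}) dual_mx dual_mx_additive.

Lemma dual_mxZ c f : dual_mx (dual_act c%:A f) = c *: dual_mx f.
Proof. by apply/matrixP=> i j; rewrite !mxE dual_actE dual_funZ. Qed.

Lemma dual_mx_inj :
  (forall x, exists c : 'I_n -> B, x = \sum_i c i *: e i) -> injective dual_mx.
Proof.
move=> eP f g fg; apply: dualP => x.
have [c ->] := eP x; rewrite !dual_fun_sum; apply: eq_bigr => i _.
rewrite (coord_vbasis (memvf (c i))) scaler_suml !dual_fun_sum.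
apply: eq_bigr => j _; rewrite !dual_funZl.
by have /matrixP/(_ i j) := fg; rewrite !mxE => ->.
Qed.
End DualMatrix.

Section DualFunctors.
Variables (k : fieldType) (A : falgType k).

(** The right action is [(f a)(x) = f (a x)]. *)
Definition ldual (M : lmodType A) : Type := dual M.
HB.instance Definition _ (M : lmodType A) := GRing.Zmodule.on (ldual M).
HB.instance Definition _ (M : lmodType A) :=
  GRing.Zmodule_isLmodule.Build A^c (ldual M)
    (@dual_actA k A M) (@dual_act1 k A M) (@dual_actDr k A M) (@dual_actDl k A M).

(** The left action is [(a f)(x) = f (x a)]. *)
Definition rdual (M : lmodType A^c) : Type := dual M.
HB.instance Definition _ (M : lmodType A^c) := GRing.Zmodule.on (rdual M).
HB.instance Definition _ (M : lmodType A^c) :=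
  GRing.Zmodule_isLmodule.Build A (rdual M)
    (@dual_actA k A^c M) (@dual_act1 k A^c M) (@dual_actDr k A^c M)
    (@dual_actDl k A^c M).

Fact ldual_fin_gen (M : lmodType A) : fin_gen M -> fin_gen (ldual M).
Proof.
move=> [n [e eP]].
apply: (@fin_gen_inj k _ A^c (ldual M) (fun c => c%:A) (dual_mx e)).
  exact: dual_mxZ.
exact: dual_mx_inj eP.
Qed.

Fact rdual_fin_gen (M : lmodType A^c) : fin_gen M -> fin_gen (rdual M).
Proof.
move=> [n [e eP]].
apply: (@fin_gen_inj k _ A (rdual M) (fun c => c%:A) (dual_mx e)).
  exact: dual_mxZ.
exact: dual_mx_inj eP.
Qed.

Definition ldual_map_fun (M N : lmodType A) (f : {linear M -> N}) :
  ldual N -> ldual M := dual_map f.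
HB.instance Definition _ (M N : lmodType A) (f : {linear M -> N}) :=
  GRing.isZmodMorphism.Build (ldual N) (ldual M) (ldual_map_fun f) (dual_mapB f).
HB.instance Definition _ (M N : lmodType A) (f : {linear M -> N}) :=
  GRing.isScalable.Build A^c (ldual N) (ldual M) _ (ldual_map_fun f) (dual_mapZ f).

Definition rdual_map_fun (M N : lmodType A^c) (f : {linear M -> N}) :
  rdual N -> rdual M := dual_map f.
HB.instance Definition _ (M N : lmodType A^c) (f : {linear M -> N}) :=
  GRing.isZmodMorphism.Build (rdual N) (rdual M) (rdual_map_fun f) (dual_mapB f).
HB.instance Definition _ (M N : lmodType A^c) (f : {linear M -> N}) :=
  GRing.isScalable.Build A (rdual N) (rdual M) _ (rdual_map_fun f) (dual_mapZ f).

Definition ldual_obj (M : fgmod A) : fgmod A^c :=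
  FgMod (ldual_fin_gen (fgmodP M)).
Definition rdual_obj (M : fgmod A^c) : fgmod A :=
  FgMod (rdual_fin_gen (fgmodP M)).

Definition ldual_map (M N : fgmod A) (f : {linear M -> N}) :
  {linear ldual_obj N -> ldual_obj M} := ldual_map_fun f.
Definition rdual_map (M N : fgmod A^c) (f : {linear M -> N}) :
  {linear rdual_obj N -> rdual_obj M} := rdual_map_fun f.

Section Conjugate.
Variable G : functor A^c A^c.

Definition dual_conj_obj (M : fgmod A) : fgmod A := rdual_obj (G (ldual_obj M)).
Definition dual_conj_map (M N : fgmod A) (f : {linear M -> N}) :
    {linear dual_conj_obj M -> dual_conj_obj N} :=
  rdual_map (fmap G (ldual_map f)).

Fact dual_conj_map_id (M : fgmod A) :
  dual_conj_map (idfun : {linear M -> M}) =1 id.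
Proof.
move=> g; apply: dualP => y; rewrite [LHS]dual_mapE; congr (dual_fun _ _).
rewrite -[RHS](@fmap_id _ _ G); congr (fmap G _ y).
by apply: linear_ext => h; apply: dualP.
Qed.

Fact dual_conj_map_comp (M1 M2 M3 : fgmod A)
    (f : {linear M1 -> M2}) (g : {linear M2 -> M3}) :
  dual_conj_map (g \o f : {linear M1 -> M3}) =1
    dual_conj_map g \o dual_conj_map f.
Proof.
move=> h; apply: dualP => y.
rewrite [LHS]dual_mapE [RHS]dual_mapE [RHS]dual_mapE; congr (dual_fun _ _).
rewrite -[RHS](@fmap_comp _ _ G); congr (fmap G _ y).
by apply: linear_ext => h'; apply: dualP.
Qed.

(** The composite [* ∘ G ∘ *]. *)
Definition dual_conj : functor A A :=
  Functor dual_conj_map_id dual_conj_map_comp.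
End Conjugate.
End DualFunctors.

Section SimpleBimodules.
Variables (k : fieldType) (A : falgType k).

(** A left [A]-module as an [A]-[k]-bimodule, a right one as a
    [k]-[A]-bimodule. *)
Definition lbim (M : lmodType A) : Type := M.
HB.instance Definition _ (M : lmodType A) := GRing.Lmodule.on (lbim M).
Definition rbim (M : lmodType A^c) : Type := M.
HB.instance Definition _ (M : lmodType A^c) := GRing.Zmodule.on (rbim M).

Section Left.
Variable M : lmodType A.
Definition lbim_ract (x : lbim M) (c : k) : lbim M := c%:A *: x.
Fact lbim_ractDl c : {morph lbim_ract^~ c : x y / x + y}.
Proof. by move=> x y; exact: scalerDr. Qed.
Fact lbim_ractDr x : {morph lbim_ract x : c d / c + d}.
Proof. by move=> c d; rewrite /lbim_ract scalerDl scalerDl. Qed.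
Fact lbim_ract1 x : lbim_ract x 1 = x.
Proof. by rewrite /lbim_ract scale1r scale1r. Qed.
Fact lbim_ractA x c d : lbim_ract (lbim_ract x c) d = lbim_ract x (c * d).
Proof. by rewrite /lbim_ract scalerA mulr_algl scalerA mulrC. Qed.
Fact lbim_ractZl a x c : lbim_ract (a *: x) c = a *: lbim_ract x c.
Proof. by rewrite /lbim_ract !scalerA mulr_algl mulr_algr. Qed.
HB.instance Definition _ := Lmodule_isBimodule.Build A k (lbim M)
  lbim_ractDl lbim_ractDr lbim_ract1 lbim_ractA lbim_ractZl.
End Left.

Section Right.
Variable M : lmodType A^c.
Definition rbim_scale (c : k) (x : rbim M) : rbim M := (c%:A : A^c) *: (x : M).
Fact rbim_scaleA c d x : rbim_scale c (rbim_scale d x) = rbim_scale (c * d) x.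
Proof. by rewrite /rbim_scale scalerA mulr_algl scalerA. Qed.
Fact rbim_scale1 : left_id 1 rbim_scale.
Proof. by move=> x; rewrite /rbim_scale scale1r scale1r. Qed.
Fact rbim_scaleDr : right_distributive rbim_scale +%R.
Proof. by move=> c x y; exact: (@scalerDr A^c M). Qed.
Fact rbim_scaleDl x : {morph rbim_scale^~ x : c d / c + d}.
Proof. by move=> c d; rewrite /rbim_scale scalerDl scalerDl. Qed.
HB.instance Definition _ := GRing.Zmodule_isLmodule.Build k (rbim M)
  rbim_scaleA rbim_scale1 rbim_scaleDr rbim_scaleDl.

Definition rbim_ract (x : rbim M) (a : A) : rbim M := (a : A^c) *: (x : M).
Fact rbim_ractDl a : {morph rbim_ract^~ a : x y / x + y}.
Proof. by move=> x y; exact: (@scalerDr A^c M). Qed.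
Fact rbim_ractDr x : {morph rbim_ract x : a b / a + b}.
Proof. by move=> a b; exact: (@scalerDl A^c M). Qed.
Fact rbim_ract1 x : rbim_ract x 1 = x.
Proof. exact: (@scale1r A^c M). Qed.
Fact rbim_ractA x a b : rbim_ract (rbim_ract x a) b = rbim_ract x (a * b).
Proof. exact: (@scalerA A^c M). Qed.
Fact rbim_ractZl c x a : rbim_ract (c *: x) a = c *: rbim_ract x a.
Proof.
rewrite /rbim_ract [c *: x]/(rbim_scale c x) [RHS]/(rbim_scale c _) /rbim_scale.
by rewrite !scalerA mulr_algl mulr_algr.
Qed.
HB.instance Definition _ := Lmodule_isBimodule.Build k A (rbim M)
  rbim_ractDl rbim_ractDr rbim_ract1 rbim_ractA rbim_ractZl.
End Right.

Definition simple_bimod (M N : lmodType A) : bimodType A A :=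
  tensor (lbim M) (rbim (ldual N)).

Lemma bker_fin_gen (N : bimodType A A) (f : bimod_hom A^o N) :
  fin_gen (bker f : lmodType A).
Proof.
apply: (@fin_gen_inj k A A (bker f) (fun c => c%:A) val); last exact: val_inj.
by move=> c u; exact: (mulr_algl c (val u : A)).
Qed.

End SimpleBimodules.

Section RadicalSequence.
Variables (k : fieldType) (A : falgType k) (n : nat) (L : 'I_n -> fgmod A).

Definition simple_list : Prop :=
  [/\ forall i, simple_module (L i),
      forall i j, mod_iso (L i) (L j) -> i = j
    & forall M : lmodType A, simple_module M -> exists i, mod_iso M (L i)].

(** [0 -> Rad A -> A -> ⊕_j L_j ⊗ L_j^* -> 0] is exact, where the map to the
    finite direct sum is given by its components [p j]. *)
Definition radical_sequence
    (p : forall j, bimod_hom A^o (simple_bimod (L j) (L j))) : Prop :=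
  (forall y : (forall j, simple_bimod (L j) (L j)),
     exists a : A, forall j, p j a = y j) /\
  (forall a : A, (forall j, p j a = 0) <-> in_jacobson a).

Definition dual_projection
    (p : forall j, bimod_hom A^o (simple_bimod (L j) (L j)))
    (i : 'I_n) : functor A A :=
  tensor_functor (bker_fin_gen (p i)).

(** The property characterizing [G_i^op] up to isomorphism. *)
Definition left_exact_projection (i : 'I_n) (G : functor A^c A^c) : Prop :=
  left_exact G /\
  nat_iso_on (fun I => injective_module I) G (proj_functor (ldual_obj (L i))).

End RadicalSequence.

(* Main.v *)
Require Import Defs.
From HB Require Import structures.
From mathcomp Require Import all_boot all_algebra all_field.
From mathcomp Require Import boolp classical_sets.

Set Implicit Arguments.
Unset Strict Implicit.
Unset Printing Implicit Defensive.

Import GRing.Theory.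
Local Open Scope ring_scope.

(** Write [D] for the duality.  It is exact, so [D ∘ G ∘ D] is right exact, and
    by Eilenberg-Watts it is tensoring with the bimodule [N] that is its value
    at [A].  Since [D A] is injective, [G (D A)] is [D A / Tr (D A)], whose dual
    is the annihilator in [D (D A) = A] of the trace of [D L_i] in [D A].  That
    trace is spanned by the matrix coefficients [a |-> g (a v)] of [L_i], so
    [N] is the annihilator of [L_i], which is [J_i]. *)

(** * Extension of linear forms and exactness of the duality *)

Section KForms.
Variables (k : fieldType) (B : falgType k).

(** The field acts on a [B]-module through the scalars [c%:A], so linear algebra over [k] is done
    with these. *)
Definition ksubspace (M : lmodType B) (U : set M) : Prop :=
  U 0 /\ forall c x y, U x -> U y -> U (c%:A *: x + y).

Lemma ksubspaceZ (M : lmodType B) (U : set M) c x :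
  ksubspace U -> U x -> U (c%:A *: x).
Proof. by move=> [U0 UP] Ux; rewrite -[X in U X]addr0; apply: UP. Qed.

Lemma ksubspaceB (M : lmodType B) (U : set M) x y :
  ksubspace U -> U x -> U y -> U (x - y).
Proof.
by move=> [U0 UP] Ux Uy; rewrite addrC -scaleN1r -scaleN1r; apply: UP.
Qed.

(** By Zorn's lemma, take [V] maximal among the subspaces meeting [U] trivially. No finiteness is
    assumed, since injectivity of a module is tested on arbitrary modules. *)
Lemma ksubspace_complement (M : lmodType B) (U : set M) :
  ksubspace U ->
  exists V : set M, [/\ ksubspace V, forall x, U x -> V x -> x = 0
    & forall z, exists x y, [/\ U x, V y & z = x + y]].
Proof.
move=> Usub.
pose P (V : set M) := ksubspace V /\ forall x, U x -> V x -> x = 0.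
have P0 : P [set x | x = 0]%classic.
  split; last by [].
  by split=> // c x y -> ->; rewrite scaler0 addr0.
(* The empty set is allowed because [Zorn_bigcup] also bounds the empty chain. *)
pose Q (V : set M) := V = set0 \/ P V.
have chainQ (F : set (set M)) :
    (F `<=` Q)%classic -> total_on F subset -> Q (\bigcup_(V in F) V)%classic.
  move=> FQ Ftot.
  have FP V x : F V -> V x -> P V.
    by move=> FV Vx; case: (FQ _ FV) => // V0; rewrite V0 in Vx.
  have [[V [FV [V0 VP]]]|noV] := pselect (exists V, F V /\ P V); last first.
    left; apply/seteqP; split=> // x [V FV Vx].
    by apply: noV; exists V; split=> //; apply: FP Vx.
  right; split; last first.
    by move=> x Ux [W FW Wx]; apply: (FP _ _ FW Wx).2.
  split; first by exists V => //; apply: V0.1.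
  move=> c x y [X FX Xx] [Y FY Yy].
  have [XY|YX] := Ftot _ _ FX FY.
    by exists Y => //; apply: (FP _ _ FY Yy).1.2 => //; apply: XY.
  by exists X => //; apply: (FP _ _ FX Xx).1.2 => //; apply: YX.
have [V [QV Vmax]] := Zorn_bigcup chainQ.
have PV : P V.
  case: QV => // V0; exfalso; apply: (Vmax [set x | x = 0]%classic).
    by rewrite V0; split=> // /(_ 0) /(_ erefl).
  by right.
have [Vsub UV0] := PV; have [V0 VP] := Vsub.
exists V; split=> // z; apply: contrapT => nz.
(* If [z] is not in [U + V], adjoining it to [V] contradicts maximality: a nonzero multiple of [z]
   in [U + V] would put [z] itself there. *)
pose W : set M := [set w | exists c v, V v /\ w = c%:A *: z + v]%classic.
apply: (Vmax W).
  split=> [v Vv|WV]; first by exists 0, v; rewrite scale0r scale0r add0r.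
  apply: nz; exists 0, z; split=> //; last by rewrite add0r.
    exact: Usub.1.
  by apply: WV; exists 1, 0; rewrite scale1r scale1r addr0.
right; split; first split.
- by exists 0, 0; rewrite scale0r scale0r addr0.
- move=> c _ _ [d [v [Vv ->]]] [d' [v' [Vv' ->]]].
  exists (c * d + d'), (c%:A *: v + v'); split; first exact: VP.
  by rewrite scalerDl scalerDl scalerDr !scalerA mulr_algl scalerA addrACA.
move=> x Ux [c [v [Vv xE]]]; have [c0|cn0] := eqVneq c 0.
  by apply: UV0 => //; rewrite xE c0 scale0r scale0r add0r.
exfalso; apply: nz; exists (c^-1%:A *: x), (0 - c^-1%:A *: v); split.
- exact: ksubspaceZ.
- by apply: ksubspaceB => //; apply: ksubspaceZ.
- rewrite sub0r xE scalerDr addrK scalerA mulr_algl scalerA mulVf //.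
  by rewrite scale1r scale1r.
Qed.

(** Compose [phi] with the projection [pr] onto [U] along a complement. *)
Lemma kform_extend (M : lmodType B) (U : set M) (phi : M -> k) :
  ksubspace U ->
  (forall c x y, U x -> U y -> phi (c%:A *: x + y) = c * phi x + phi y) ->
  exists psi : dual M, forall x, U x -> psi x = phi x.
Proof.
move=> Usub phiP.
have [V [Vsub UV0 UVT]] := ksubspace_complement Usub.
have [pr prP] := choice UVT.
have prE x u v : U u -> V v -> x = u + v -> pr x = u.
  move=> Uu Vv xE; have [y [Upr Vy xE']] := prP x.
  apply/subr0_eq/UV0; first exact: ksubspaceB.
  have -> : pr x - u = v - y.
    by apply/eqP; rewrite subr_eq addrAC [v + u]addrC -xE {2}xE' addrK.
  exact: ksubspaceB.
have prU x : U x -> pr x = x.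
  by move=> Ux; apply: (prE _ _ 0) => //; [case: Vsub|rewrite addr0].
have prZD c x y : pr (c%:A *: x + y) = c%:A *: pr x + pr y.
  have [v [Ux Vv xE]] := prP x; have [w [Uy Vw yE]] := prP y.
  apply: (prE _ _ (c%:A *: v + w)); [exact: Usub.2|exact: Vsub.2|].
  by rewrite {1}xE {1}yE scalerDr addrACA.
have Upr x : U (pr x) by have [v []] := prP x.
have kform : kform_pred (fun x => phi (pr x) : k^o).
  apply/asboolP; split=> [x y|c x].
    have := phiP 1 (pr x) (pr y) (Upr x) (Upr y).
    by rewrite -prZD !scale1r mul1r.
  have phi0 : phi 0 = 0.
    have := phiP 1 0 0 Usub.1 Usub.1.
    rewrite scaler0 addr0 mul1r => /eqP.
    by rewrite -subr_eq0 opprD addNKr oppr_eq0 => /eqP.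
  have pr0 : pr 0 = 0 by apply: prU; case: Usub.
  by have := prZD c x 0; rewrite !addr0 pr0 addr0 => ->;
     rewrite -[X in phi X]addr0 phiP ?phi0 ?addr0 //; case: Usub.
by exists (Sub _ kform) => x Ux; rewrite /dual_fun /= prU.
Qed.

Lemma dual_factor (M N : lmodType B) (f : {linear M -> N}) (phi : dual M) :
  (forall x, f x = 0 -> phi x = 0) ->
  exists psi : dual N, forall x, psi (f x) = phi x.
Proof.
move=> kerf.
pose U : set N := [set y | exists x, f x = y]%classic.
(* [s] chooses preimages under [f], with default 0 off the image. Two preimages differ by an element
   of the kernel, so [phi \o s] is well determined on the image. *)
have /choice[s sP] y : exists x, U y -> f x = y.
  have [[x <-]|] := pselect (U y); first by exists x.
  by move=> nUy; exists 0.
have phis x y : f x = y -> phi (s y) = phi x.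
  move=> fxy; apply/subr0_eq; rewrite -dual_funB; apply: kerf.
  by rewrite raddfB /= fxy sP ?subrr //; exists x.
have [||psi psiP] := @kform_extend N U (phi \o s).
- split; first by exists 0; rewrite raddf0.
  by move=> c _ _ [x <-] [y <-]; exists (c%:A *: x + y); rewrite linearP.
- move=> c _ _ [x <-] [y <-] /=; rewrite (phis (c%:A *: x + y)) ?linearP //.
  by rewrite (phis x) // (phis y) // dual_funD dual_funZ.
by exists psi => x; rewrite psiP /= ?(phis x) //; exists x.
Qed.

Lemma dual_separates (M : lmodType B) (w : M) :
  w != 0 -> exists psi : dual M, psi w = 1.
Proof.
move=> wn0.
have wI c d : c%:A *: w = d%:A *: w -> c = d.
  move=> /eqP; rewrite -subr_eq0 -scalerBl -scalerBl => /eqP cdw.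
  apply/eqP; rewrite -subr_eq0; apply: contraNT wn0 => cd.
  rewrite -[w]scale1r -[1]scale1r -(mulVf cd) -scalerA -mulr_algl -scalerA.
  by rewrite cdw scaler0.
pose U : set M := [set x | exists c, x = c%:A *: w]%classic.
(* [s] is the coordinate along the line spanned by [w], with default 0 off it; [wI] makes this
   coordinate unique and hence linear. *)
have /choice[s sP] x : exists c : k, U x -> x = c%:A *: w.
  have [[c ->]|] := pselect (U x); first by exists c.
  by move=> nUx; exists 0.
have [||psi psiP] := @kform_extend M U s.
- split; first by exists 0; rewrite scale0r scale0r.
  move=> c _ _ [x ->] [y ->]; exists (c * x + y).
  by rewrite scalerDl scalerDl !scalerA mulr_algl scalerA.
- move=> c x y Ux Uy; apply: wI; rewrite -sP; last first.
    have [[d ->] [e ->]] := (Ux, Uy); exists (c * d + e).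
    by rewrite scalerDl scalerDl !scalerA mulr_algl scalerA.
  rewrite {1}(sP x) // {1}(sP y) // scalerDl scalerDl !scalerA.
  by rewrite mulr_algl scalerA.
have Uw : U w by exists 1; rewrite scale1r scale1r.
by exists psi; rewrite psiP //; apply: wI; rewrite -sP // scale1r scale1r.
Qed.

(** A form vanishing on the image of [f] vanishes on the kernel of [g], so it factors through
    [g]. *)
Lemma dual_map_exact (X Y Z : lmodType B)
    (f : {linear X -> Y}) (g : {linear Y -> Z}) :
  exact_at f g ->
  forall h : dual Y, dual_map f h = 0 <-> exists p, dual_map g p = h.
Proof.
move=> fg h; split=> [hf0|[p <-]]; last first.
  apply: dualP => x; rewrite 2!dual_mapE.
  by have /fg -> : exists x', f x' = f x; [exists x|rewrite dual_fun0].
have [y /fg[x <-]|psi psiP] := @dual_factor _ _ g h.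
  exact: (congr1 (fun r : dual X => r x) hf0).
by exists psi; apply: dualP => y; exact: psiP.
Qed.

End KForms.

(** * Kernels, orbit maps and free modules of finite rank *)

Section LinearKernel.
Variables (R : nzRingType) (M N : lmodType R) (f : {linear M -> N}).

Definition lkernel_pred : pred M := fun x => f x == 0.

Fact lkernel_pred_submod : GRing.subsemimod_closed lkernel_pred.
Proof.
apply: GRing.submod_closed_semi; split; first by apply/eqP; exact: linear0.
move=> a x y /eqP fx0 /eqP fy0; apply/eqP.
by rewrite linearP fx0 fy0 scaler0 addr0.
Qed.
HB.instance Definition _ :=
  GRing.isSubmodClosed.Build R M lkernel_pred lkernel_pred_submod.

Definition lkernel : Type := {x | lkernel_pred x}.
HB.instance Definition _ := SubChoice.on lkernel.
HB.instance Definition _ := [SubChoice_isSubLmodule of lkernel by <:].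

Definition lkernel_incl : lkernel -> M := val.
Fact lkernel_incl_linear : linear lkernel_incl.
Proof. by []. Qed.
HB.instance Definition _ :=
  GRing.isLinear.Build R lkernel M _ lkernel_incl lkernel_incl_linear.

Lemma lkernel_exact : exact_at lkernel_incl f.
Proof.
move=> y; split=> [fy0|[x <-]]; last exact/eqP/(valP x).
by have fy := introT eqP fy0; exists (Sub y fy).
Qed.

End LinearKernel.

Section OrbitMap.
Variables (R : nzRingType) (M : lmodType R) (m : M).

(** The map out of the regular module with [1 |-> m]. When [M] is the regular module itself, this is
    right multiplication by [m]. *)
Definition orbit_map : R^o -> M := fun a => a *: m.
Fact orbit_map_linear : linear orbit_map.
Proof. by move=> a x y; rewrite /orbit_map scalerDl scalerA. Qed.
HB.instance Definition _ :=
  GRing.isLinear.Build R R^o M _ orbit_map orbit_map_linear.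

End OrbitMap.

Section Regular.
Variable R : nzRingType.

Lemma regular_fin_gen : fin_gen (R^o : lmodType R).
Proof.
exists 1%N, (fun=> 1) => x; exists (fun=> x).
by rewrite big_ord1; exact: (esym (mulr1 x)).
Qed.
Definition regular_obj : fgmod R := FgMod regular_fin_gen.

Lemma row_fin_gen n : fin_gen ('rV[R]_n : lmodType R).
Proof.
exists n, (fun i => delta_mx 0 i) => x; exists (fun i => x 0 i).
exact: row_sum_delta.
Qed.
Definition row_obj n : fgmod R := FgMod (row_fin_gen n).

Definition row_coord n (j : 'I_n) : 'rV[R]_n -> R^o := fun x => x 0 j.
Fact row_coord_linear n (j : 'I_n) : linear (@row_coord n j).
Proof. by move=> a x y; rewrite /row_coord !mxE. Qed.
HB.instance Definition _ n (j : 'I_n) :=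
  GRing.isLinear.Build R 'rV[R]_n R^o _ (@row_coord n j) (@row_coord_linear n j).

Definition row_comb (M : lmodType R) n (e : 'I_n -> M) : 'rV[R]_n -> M :=
  fun x => \sum_i x 0 i *: e i.
Fact row_comb_linear (M : lmodType R) n (e : 'I_n -> M) :
  linear (@row_comb M n e).
Proof.
move=> a x y; rewrite /row_comb scaler_sumr -big_split /=.
by apply: eq_bigr => i _; rewrite !mxE scalerDl scalerA.
Qed.
HB.instance Definition _ (M : lmodType R) n (e : 'I_n -> M) :=
  GRing.isLinear.Build R 'rV[R]_n M _ (@row_comb M n e) (@row_comb_linear M n e).

End Regular.

(** * Right exact and additive functors *)

Definition right_exact (R S : nzRingType) (F : functor R S) : Prop :=
  (forall (M N : fgmod R) (f g : {linear M -> N}),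
     fmap F (f \+ g : {linear M -> N}) =1 fmap F f \+ fmap F g) /\
  (forall (X Y Z : fgmod R) (f : {linear X -> Y}) (g : {linear Y -> Z}),
     (forall z, exists y, g y = z) -> exact_at f g ->
     (forall z, exists y, fmap F g y = z) /\ exact_at (fmap F f) (fmap F g)).

Section Additive.
Variables (R S : nzRingType) (F : functor R S).
Hypothesis F_add : forall (M N : fgmod R) (f g : {linear M -> N}),
  fmap F (f \+ g : {linear M -> N}) =1 fmap F f \+ fmap F g.

Lemma eq_fmap (M N : fgmod R) (f g : {linear M -> N}) :
  f =1 g -> fmap F f =1 fmap F g.
Proof. by move=> /linear_ext ->. Qed.

Lemma fmap0 (M N : fgmod R) : fmap F (\0 : {linear M -> N}) =1 \0.
Proof.
move=> x; apply: (@addIr _ (fmap F (\0 : {linear M -> N}) x)).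
rewrite add0r; have /= <- := F_add \0 \0 x.
by apply: eq_fmap => y /=; rewrite addr0.
Qed.

Lemma fmap_sum (M N : fgmod R) n (f : 'I_n -> {linear M -> N})
    (g : {linear M -> N}) :
  (forall x, g x = \sum_i f i x) ->
  forall x, fmap F g x = \sum_i fmap F (f i) x.
Proof.
(* A finite sum of linear maps is built with binary [\+], the only form of addition to which [F_add]
   applies. *)
have linsum m (h : 'I_m -> {linear M -> N}) :
    exists s : {linear M -> N}, forall y, s y = \sum_i h i y.
  elim: m h => [|m IHm] h; first by exists \0 => y; rewrite big_ord0.
  have [s sE] := IHm (fun i => h (lift ord0 i)).
  by exists (h ord0 \+ s) => y; rewrite big_ord_recl /= sE.
elim: n f g => [|n IHn] f g gE x.
  rewrite big_ord0; apply: etrans (@fmap0 M N x).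
  by apply: eq_fmap => y; rewrite gE big_ord0.
have [h hE] := linsum _ (fun i => f (lift ord0 i)).
rewrite big_ord_recl -(IHn _ _ hE x); have /= <- := F_add (f ord0) h x.
by apply: eq_fmap => y; rewrite gE big_ord_recl /= hE.
Qed.

End Additive.

(** * The Eilenberg-Watts theorem *)

Section EilenbergWatts.
Variables (R S : nzRingType) (F : functor S R) (N : bimodType R S).
Hypothesis S_noeth : forall n (M : lmodType S) (f : {linear 'rV[S]_n -> M}),
  fin_gen (lkernel f).
Hypothesis N_fin_gen : fin_gen (N : lmodType R).
Hypothesis F_rexact : right_exact F.
Variable theta : {linear N -> F (regular_obj S)}.
Hypothesis theta_bij : bijective theta.
(** [F] of the regular module is a right [S]-module by functoriality, through right multiplications;
    [theta] has to respect this structure. *)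
Hypothesis theta_ract : forall x (s : S),
  theta (ract x s) =
    fmap F (orbit_map (s : S^o) : {linear regular_obj S -> regular_obj S})
      (theta x).

Definition ew_orbit (M : fgmod S) (m : M) : {linear regular_obj S -> M} :=
  orbit_map m.

Fact ew_balanced (M : fgmod S) :
  balanced (fun (x : N) (m : M) => fmap F (ew_orbit m) (theta x)).
Proof.
split=> [m x y|x m m'|x s m]; first by rewrite !raddfD.
  have /= <- := F_rexact.1 _ _ (ew_orbit m) (ew_orbit m') (theta x).
  by apply: eq_fmap => a; rewrite /= /orbit_map scalerDr.
rewrite theta_ract -[LHS](fmap_comp _ _ (theta x)).
by apply: eq_fmap => a; rewrite /= /orbit_map scalerA.
Qed.

(** The comparison map. At the regular module it is [theta] up to the identification of [N ⊗ S] with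
    [N]. *)
Definition ew_map (M : fgmod S) : tensor N M -> F M :=
  tensor_lift (@ew_balanced M).
HB.instance Definition _ (M : fgmod S) := GRing.Additive.on (@ew_map M).

Lemma ew_mapE (M : fgmod S) x (m : M) :
  ew_map (tens x m) = fmap F (ew_orbit m) (theta x).
Proof. exact: tensor_liftE. Qed.

Fact ew_map_scalable (M : fgmod S) : scalable (@ew_map M).
Proof.
move=> a t; elim/tensor_ind: t => [|t t' IHt IHt'|x m].
- by rewrite scaler0 !raddf0.
- by rewrite scalerBr !raddfB /= IHt IHt'.
- by rewrite tensZl !ew_mapE !linearZ.
Qed.
HB.instance Definition _ (M : fgmod S) := GRing.isScalable.Build R (tensor N M)
  (F M) _ (@ew_map M) (@ew_map_scalable M).

Lemma ew_map_natural (M M' : fgmod S) (f : {linear M -> M'}) t :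
  ew_map (tensorl_map_fun f t) = fmap F f (ew_map t).
Proof.
elim/tensor_ind: t => [|t t' IHt IHt'|x m].
- by rewrite !raddf0.
- by rewrite !raddfB /= IHt IHt'.
- rewrite tensorl_map_funE !ew_mapE -[RHS](fmap_comp _ _ (theta x)).
  by apply: eq_fmap => a; rewrite /= /orbit_map linearZ.
Qed.

(** Coefficients move across the tensor sign into [N]. *)
Lemma tensor_comb (M : lmodType S) n (e : 'I_n -> M) :
  (forall y, exists c : 'I_n -> S, y = \sum_i c i *: e i) ->
  forall t : tensor N M, exists x : 'I_n -> N, t = \sum_i tens (x i) (e i).
Proof.
move=> eP; elim/tensor_ind=> [|t u [x ->] [y ->]|x m].
- by exists (fun=> 0); rewrite big1 // => i _; rewrite tens0l.
- exists (fun i => x i - y i); rewrite -sumrB; apply: eq_bigr => i _.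
  by apply: (@addIr _ (tens (y i) (e i))); rewrite subrK -tensDl subrK.
- have [c ->] := eP m; exists (fun i => ract x (c i)).
  by rewrite tens_sumr; apply: eq_bigr => i _; rewrite tens_bal.
Qed.

Lemma ew_map_row_inj n (t : tensor N 'rV[S]_n) :
  ew_map (M := row_obj S n) t = 0 -> t = 0.
Proof.
have rowP (y : 'rV[S]_n) :
    exists c : 'I_n -> S, y = \sum_i c i *: delta_mx 0 i.
  by exists (fun i => y 0 i); exact: row_sum_delta.
have [x ->] := tensor_comb rowP t => t0.
apply: big1 => j _; suff -> : x j = 0 by exact: tens0l.
apply: (bij_inj theta_bij); rewrite raddf0.
(* Applying [F] of the [j]-th coordinate to the image of [t] leaves only [theta (x j)]. *)
pose cj : {linear row_obj S n -> regular_obj S} := @row_coord S n j.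
have := congr1 (fmap F cj) t0.
rewrite raddf0 raddf_sum raddf_sum (bigD1 j) //= big1 ?addr0 => [|i ij].
  rewrite ew_mapE -[X in X = 0](fmap_comp _ _ (theta (x j))).
  rewrite (eq_fmap (g := idfun)) ?fmap_id // => a /=.
  by rewrite /row_coord /orbit_map !mxE !eqxx; exact: mulr1.
rewrite ew_mapE -[LHS](fmap_comp _ _ (theta (x i))).
rewrite (eq_fmap (g := \0)) ?(fmap0 F_rexact.1) // => a /=.
by rewrite /row_coord /orbit_map !mxE eqxx eq_sym (negPf ij); exact: mulr0.
Qed.

Lemma ew_map_row_surj n (y : F (row_obj S n)) : exists t, ew_map t = y.
Proof.
have [theta' _ theta'K] := theta_bij.
pose cj j : {linear row_obj S n -> regular_obj S} := @row_coord S n j.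
pose ij (j : 'I_n) : {linear regular_obj S -> row_obj S n} :=
  orbit_map (delta_mx 0 j : 'rV[S]_n).
(* The identity of the free module is the sum of the [ij j \o cj j]; additivity of [F] decomposes
   [y] accordingly. *)
exists (\sum_j tens (theta' (fmap F (cj j) y)) (delta_mx 0 j : 'rV[S]_n)).
rewrite raddf_sum -[RHS]fmap_id.
rewrite (fmap_sum F_rexact.1 (f := fun j => ij j \o cj j)) => [|x].
  apply: eq_bigr => j _; rewrite /= ew_mapE theta'K.
  by rewrite -[LHS](fmap_comp (cj j) (ij j) y).
by rewrite [LHS]row_sum_delta.
Qed.

(** [S_noeth] makes the module of relations finitely generated, so that [F] can be applied to it. *)
Lemma fgmod_presentation (M : fgmod S) :
  exists (n : nat) (pi : {linear row_obj S n -> M}) (K : fgmod S)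
    (sg : {linear K -> row_obj S n}),
    (forall z, exists y, pi y = z) /\ exact_at sg pi.
Proof.
have [n [e eP]] := fgmodP M.
pose pi : {linear row_obj S n -> M} := row_comb e.
exists n, pi, (FgMod (S_noeth pi)), (@lkernel_incl _ _ _ pi).
split; last exact: lkernel_exact.
move=> z; have [c ->] := eP z; exists (\row_i c i).
by apply: eq_bigr => i _; rewrite mxE.
Qed.

(** [F pi] is onto by right exactness, which reduces the claim to free modules by naturality. *)
Lemma ew_map_surj (M : fgmod S) (y : F M) : exists t, ew_map t = y.
Proof.
have [n [pi [K [sg [pi_surj sg_exact]]]]] := fgmod_presentation M.
have [Fpi_surj _] := F_rexact.2 _ _ _ sg pi pi_surj sg_exact.
have [z <-] := Fpi_surj y; have [t <-] := ew_map_row_surj z.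
by exists (tensorl_map_fun pi t); rewrite ew_map_natural.
Qed.

(* Surjectivity at the kernel of a presentation gives injectivity. *)
Lemma ew_map_inj (M : fgmod S) (t : tensor N M) : ew_map t = 0 -> t = 0.
Proof.
have [n [pi [K [sg [pi_surj sg_exact]]]]] := fgmod_presentation M.
have [_ F_exact] := F_rexact.2 _ _ _ sg pi pi_surj sg_exact.
have [u <-] : exists u, tensorl_map_fun pi u = t.
  elim/tensor_ind: t => [|_ _ [u <-] [v <-]|x m].
  - by exists 0; rewrite raddf0.
  - by exists (u - v); rewrite raddfB.
  - have [z <-] := pi_surj m; exists (tens x z); exact: tensorl_map_funE.
rewrite ew_map_natural => /F_exact[z]; have [v <-] := ew_map_surj z.
rewrite -ew_map_natural => /eqP; rewrite eq_sym -subr_eq0 -raddfB => /eqP.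
move=> /ew_map_row_inj /subr0_eq ->.
elim/tensor_ind: v => [|v w IHv IHw|x m].
- by rewrite !raddf0.
- by rewrite !raddfB /= IHv IHw subrr.
- rewrite !tensorl_map_funE.
  by have /sg_exact -> : exists y, sg y = sg m; [exists m|rewrite tens0r].
Qed.

Theorem eilenberg_watts : nat_iso (tensor_functor N_fin_gen) F.
Proof.
exists (fun M => @ew_map M : {linear tensor_functor N_fin_gen M -> F M}).
split=> [M _|M M' f _ _ t]; last exact: ew_map_natural.
have /choice[g gK] := @ew_map_surj M; exists g => // t.
apply/subr0_eq/ew_map_inj; apply/eqP.
by rewrite raddfB /= gK subrr.
Qed.

End EilenbergWatts.

(** * Duality for modules, and the dual of the regular module *)

Section DualExact.
Variables (k : fieldType) (A : falgType k).

Lemma ldual_exact (X Y Z : fgmod A) (f : {linear X -> Y}) (g : {linear Y -> Z}) :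
  (forall z, exists y, g y = z) -> exact_at f g ->
  injective (ldual_map g) /\ exact_at (ldual_map g) (ldual_map f).
Proof.
move=> g_surj fg; split=> [p q pq|]; last exact: dual_map_exact fg.
apply: dualP => z; have [y <-] := g_surj z.
by have := congr1 (fun r : dual Y => r y) pq.
Qed.

Lemma rdual_exact (X Y Z : fgmod A^c)
    (f : {linear X -> Y}) (g : {linear Y -> Z}) :
  injective f -> exact_at f g ->
  (forall p, exists q, rdual_map f q = p) /\
  exact_at (rdual_map g) (rdual_map f).
Proof.
move=> f_inj fg; split=> [p|]; last exact: dual_map_exact fg.
have [x fx0|psi psiP] := @dual_factor _ _ _ _ f p.
  by rewrite (f_inj x 0) ?dual_fun0 // fx0 linear0.
by exists psi; apply: dualP => y; exact: psiP.
Qed.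

(** The first duality makes a right exact sequence left exact, [G] preserves it, and the second
    duality turns it back. *)
Lemma dual_conj_right_exact (G : functor A^c A^c) :
  left_exact G -> right_exact (dual_conj G).
Proof.
move=> [G_add G_exact]; split=> [M N f g h|X Y Z f g g_surj fg].
  apply: dualP => y; rewrite [LHS]dual_mapE.
  rewrite (eq_fmap (g := ldual_map f \+ ldual_map g)) => [|p]; last first.
    by apply: dualP => x; exact: dual_funD.
  by rewrite G_add; exact: dual_funD.
have [g_inj gf] := ldual_exact g_surj fg.
have [Gg_inj Ggf] := G_exact _ _ _ _ _ g_inj gf.
exact: rdual_exact Gg_inj Ggf.
Qed.

(** The kernel embeds [k]-linearly into a finite dimensional space. The target is
    [{ffun 'I_n -> A}], which is a space over [k], whereas rows are scaled by [A]. *)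
Lemma lkernel_fin_gen n (M : lmodType A) (f : {linear 'rV[A]_n -> M}) :
  fin_gen (lkernel f).
Proof.
pose phi (u : lkernel f) : {ffun 'I_n -> A} := [ffun i => val u 0 i].
have phiB : zmod_morphism phi.
  by move=> u v; apply/ffunP=> i; rewrite !ffunE !mxE.
pose phiA := HB.pack_for {additive lkernel f -> {ffun 'I_n -> A}} phi
  (GRing.isZmodMorphism.Build _ _ phi phiB).
apply: (@fin_gen_inj k {ffun 'I_n -> A} A (lkernel f) (fun c => c%:A) phiA).
  by move=> c u; apply/ffunP => i; rewrite !ffunE !mxE mulr_algl.
move=> u v uv; apply/val_inj/rowP => i.
by have := congr1 (fun h : {ffun 'I_n -> A} => h i) uv; rewrite !ffunE.
Qed.

(** Evaluation at 1 identifies homomorphisms [Y -> D A] with linear forms on [Y], and forms extend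
    along injections. *)
Lemma ldual_regular_injective :
  injective_module (ldual_obj (regular_obj A) : lmodType A^c).
Proof.
move=> X Y u f u_inj.
pose ev1 (x : X) : k^o := dual_fun (f x : dual A^o) 1.
have ev1P : kform_pred ev1.
  apply/asboolP; split=> [x y|c x]; first by rewrite /ev1 raddfD.
  rewrite /ev1 linearZ /=.
  rewrite -[LHS]/(dual_fun (f x : dual A^o) (c%:A * 1)).
  exact: dual_funZ.
have [x ux0|psi psiP] := @dual_factor _ _ _ _ u (Sub ev1 ev1P : dual X).
  by rewrite (u_inj x 0) ?dual_fun0 // ux0 linear0.
(* The homomorphism is recovered from its form at 1: it sends [y] to [a |-> psi (y a)]. *)
have gP y : kform_pred (fun a : A^o => psi ((a : A^c) *: y) : k^o).
  apply/asboolP; split=> [a b|c a]; first by rewrite scalerDl dual_funD.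
  rewrite -dual_funZl; congr (dual_fun psi (_ *: _)).
  exact: (mulr_algl c (a : A)).
pose g (y : Y) : ldual_obj (regular_obj A) := (Sub _ (gP y) : dual A^o).
have gL : linear g.
  move=> b x y; apply: dualP => a.
  rewrite -[LHS]/(psi (_ *: _)) scalerDr scalerA dual_funD.
  by congr (_ + _).
exists (HB.pack_for {linear Y -> ldual_obj (regular_obj A)} g
  (GRing.isLinear.Build A^c Y (ldual_obj (regular_obj A)) _ g gL)) => x /=.
apply: dualP => a; rewrite -[LHS]/(psi (_ *: _)) -linearZ psiP.
rewrite -[LHS]/(dual_fun (f (_ *: x) : dual A^o) 1) linearZ /=.
rewrite -[LHS]/(dual_fun (f x : dual A^o) (a * 1)).
by rewrite mulr1.
Qed.

Lemma regular_reflexive (Phi : dual (ldual_obj (regular_obj A))) :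
  exists a : A, forall f : dual A^o, Phi f = f a.
Proof.
pose e (i : 'I_(\dim {:A})) : A := (vbasis {:A})`_i.
have cP i : kform_pred (fun a : A^o => coord (vbasis {:A}) i a : k^o).
  apply/asboolP; split=> [a b|c a]; first exact: (raddfD (coord (vbasis {:A}) i)).
  by rewrite -[c%:A *: a]/(c%:A * (a : A)) mulr_algl linearZ.
pose co i : ldual_obj (regular_obj A) := (Sub _ (cP i) : dual A^o).
(* The [co i] are the basis dual to the [e i], so the values of [Phi] on them are the coordinates of
   the required element. *)
exists (\sum_i Phi (co i) *: e i) => f.
have fZ c (x : A) : f (c *: x) = c * f x.
  by rewrite -mulr_algl; exact: dual_funZ.
have fE : f = \sum_i ((f (e i))%:A : A^c) *: co i :> ldual_obj (regular_obj A).
  apply: dualP => a; rewrite {1}(coord_vbasis (memvf a)) dual_fun_sum.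
  have -> : dual_fun (\sum_i ((f (e i))%:A : A^c) *: co i : dual A^o) a =
      \sum_i dual_fun (((f (e i))%:A : A^c) *: co i : dual A^o) a.
    exact: (big_morph (fun g : dual A^o => g a)).
  apply: eq_bigr => i _; rewrite fZ.
  rewrite -[RHS]/(coord (vbasis {:A}) i ((f (e i))%:A * a)).
  by rewrite mulr_algl linearZ mulrC.
rewrite [in LHS]fE !dual_fun_sum; apply: eq_bigr => i _.
by rewrite dual_funZ fZ mulrC.
Qed.

End DualExact.

(** * The value at the regular module: the kernel of [q] as an annihilator *)

Section SimpleKernel.
Variables (k : fieldType) (A : falgType k) (L : fgmod A).
Variable q : bimod_hom A^o (simple_bimod L L).
Hypothesis q_surj : forall y, exists a, q a = y.
Hypothesis L_neq0 : exists v : L, v != 0.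

(** As [q] is a bimodule map, [q a = 0] gives [a *: q b = q (a b) = 0] for all [b], so [a] kills the
    whole target of [q]. Conversely [q a = a *: q 1]. *)
Lemma simple_kernelP (a : A) : q a = 0 <-> forall v : L, a *: v = 0.
Proof.
split=> [qa0 v|aL0].
  have [w wn0] := L_neq0; have [g gw] := dual_separates wn0.
  (* Contraction of the second factor against [w] sends [v ⊗ g] to [v], because [g w = 1]. *)
  have bal : balanced (N := lbim L) (M := rbim (ldual L))
      (fun (x : L) (h : dual L) => (h w)%:A *: x).
    split=> [h x y|x h h'|x c h]; first exact: scalerDr.
      by rewrite -scalerDl -scalerDl.
    rewrite -[ract x c]/(c%:A *: (x : L)) scalerA mulr_algl scalerA.
    have -> : ((c *: h : rbim (ldual L)) : dual L) w = c * (h : dual L) w.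
      exact: dual_funZ.
    by rewrite mulrC.
  have [b qb] := q_surj (tens (v : lbim L) (g : rbim (ldual L))).
  have : a *: q b = 0.
    rewrite -linearZ -[a *: b]/(ract (a : A^o) b) bimod_funP qa0; exact: ract0.
  rewrite qb tensZl => /(congr1 (tensor_lift bal)).
  by rewrite raddf0 tensor_liftE gw scale1r scale1r.
rewrite -[a]mulr1 -[a * 1]/(a *: (1 : A^o)) linearZ.
elim/tensor_ind: (q 1) => [|t u t0 u0|x m]; first exact: scaler0.
  by rewrite [LHS](@scalerBr A (simple_bimod L L)) t0 u0 subrr.
by rewrite [LHS](tensZl a x m) [a *: x]aL0; exact: tens0l.
Qed.

Let I := ldual_obj (regular_obj A).
Let tr : {pred I} := @trace A^c (ldual_obj L) I.

(** For a homomorphism [h] from [D L] to [D A], the value of [h y] at [j] is that of [h (y j)] at 1,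
    and [y j = 0] since [j] annihilates [L]. *)
Lemma trace_kernel (f : I) (j : A) :
  f \in tr -> q j = 0 -> dual_fun (f : dual A^o) j = 0.
Proof.
move=> /asboolP[n [h [y ->]]] /simple_kernelP jL0.
have -> : dual_fun (\sum_i h i (y i) : dual A^o) j =
    \sum_i dual_fun (h i (y i) : dual A^o) j.
  exact: (big_morph (fun g : dual A^o => g j)).
apply: big1 => i _; rewrite -[j]mulr1.
rewrite -[LHS]/(dual_fun ((j : A^c) *: h i (y i) : dual A^o) 1) -linearZ.
have -> : (j : A^c) *: y i = 0; last by rewrite linear0.
apply: dualP => v; rewrite [LHS]/(dual_fun (y i : dual L) (j *: v)) jL0.
exact: dual_fun0.
Qed.

(** If [a v] is nonzero, some matrix coefficient [b |-> g (b v)] is nonzero at [a]; it is in the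
    trace as the image of [g] under the dual of the orbit map of [v]. *)
Lemma trace_separates (a : A) :
  (forall f : I, f \in tr -> dual_fun (f : dual A^o) a = 0) -> q a = 0.
Proof.
move=> fa0; apply/simple_kernelP => v; apply/eqP; apply: contraT => avn0.
have [g gav] := dual_separates avn0.
pose om : {linear regular_obj A -> L} := orbit_map v.
have /fa0 : ldual_map om g \in tr.
  apply/asboolP; exists 1%N, (fun=> ldual_map om), (fun=> g).
  by rewrite big_ord1.
by rewrite [LHS]gav => /eqP; rewrite oner_eq0.
Qed.

Variable G : functor A^c A^c.
Variable eps : forall M : fgmod A^c, {linear G M -> proj_functor (ldual_obj L) M}.
Hypothesis eps_bij : bijective (eps I).
Hypothesis eps_nat : forall f : {linear I -> I},
  eps I \o fmap G f =1 fmap (proj_functor (ldual_obj L)) f \o eps I.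

(** Evaluation at [j] on classes modulo the trace, through a representative; [quot_ev_pi] shows
    independence of the choice. *)
Definition quot_ev (j : bker q) (z : proj_obj (ldual_obj L) I) : k :=
  dual_fun (quotm_repr z : dual A^o) (val j).

Lemma quot_ev_pi (j : bker q) (f : I) :
  quot_ev j (quotm_pi (trace_submod_closed (ldual_obj L) I) f) =
  dual_fun (f : dual A^o) (val j).
Proof.
apply/subr0_eq; rewrite /quot_ev.
set f' := quotm_repr _.
rewrite -[LHS]/(dual_fun (f' - f : dual A^o) (val j)).
apply: trace_kernel; last exact/eqP/(valP j).
apply/(quotm_piE (trace_submod_closed (ldual_obj L) I)).
by rewrite /f' quotm_reprK.
Qed.

Fact kernel_form_subproof (j : bker q) :
  kform_pred (fun y : G I => quot_ev j (eps I y) : k^o).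
Proof.
have evP c (y z : proj_obj (ldual_obj L) I) :
    quot_ev j ((c%:A : A^c) *: y + z) = c * quot_ev j y + quot_ev j z.
  rewrite -[y]quotm_reprK -[z]quotm_reprK -linearP !quot_ev_pi.
  rewrite -[LHS]/(dual_fun (quotm_repr y : dual A^o) (c%:A * val j) + _).
  by congr (_ + _); exact: dual_funZ.
apply/asboolP; split=> [x y|c x].
  by have := evP 1 (eps I x) (eps I y); rewrite !scale1r mul1r raddfD.
have := evP c (eps I x) 0; rewrite addr0 -linearZ => ->.
(* This instance forces [quot_ev j 0 = 0]. *)
have := evP 1 0 0; rewrite !scale1r addr0 mul1r => /eqP.
by rewrite -subr_eq0 opprD addNKr oppr_eq0 => /eqP ->; rewrite addr0.
Qed.

(** This is the [theta] of the Eilenberg-Watts theorem for [dual_conj G]. *)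
Definition kernel_form (j : bker q) : dual_conj G (regular_obj A) :=
  (Sub _ (kernel_form_subproof j) : dual (G I)).

Lemma kernel_formE (j : bker q) (y : G I) :
  dual_fun (kernel_form j : dual (G I)) y = quot_ev j (eps I y).
Proof. by []. Qed.

Fact kernel_form_linear : linear kernel_form.
Proof.
move=> b j j'; apply: dualP => y.
rewrite -[RHS]/(dual_fun (kernel_form j : dual (G I)) ((b : A^c) *: y) +
  dual_fun (kernel_form j' : dual (G I)) y) !kernel_formE linearZ.
rewrite -[eps I y]quotm_reprK -linearZ !quot_ev_pi.
exact: (dual_funD (quotm_repr (eps I y) : dual A^o) (b * val j) (val j')).
Qed.
HB.instance Definition _ := GRing.isLinear.Build A (bker q)
  (dual_conj G (regular_obj A)) _ kernel_form kernel_form_linear.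

Lemma kernel_form_inj (j : bker q) : kernel_form j = 0 -> j = 0.
Proof.
have [eps' _ eps'K] := eps_bij.
move=> j0; apply: val_inj; apply/eqP; rewrite /=; apply: contraT => jn0.
have [g gj] := dual_separates (M := A^o) jn0.
(* A form [g] with value 1 at [j] gives a class on which [kernel_form j] does not vanish. *)
pose z := quotm_pi (trace_submod_closed (ldual_obj L) I) (g : I).
have := congr1 (fun h : dual (G I) => h (eps' z)) j0.
by rewrite kernel_formE eps'K quot_ev_pi gj => /eqP; rewrite oner_eq0.
Qed.

Lemma kernel_form_surj (h : dual (G I)) : exists j, kernel_form j = h.
Proof.
have [eps' epsK eps'K] := eps_bij.
pose pi := @quotm_pi _ _ _ (trace_submod_closed (ldual_obj L) I).
(* Pulled back to [D A], [h] is evaluation at some [a] by reflexivity. It vanishes on the trace,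
   which places [a] in the kernel of [q]. *)
have PhiP : kform_pred (fun f : I => h (eps' (pi f)) : k^o).
  have eps'D : {morph eps' : y z / y + z}.
    by move=> y z; apply: (bij_inj eps_bij); rewrite raddfD /= !eps'K.
  have eps'Z (c : A^c) : {morph eps' : y / c *: y}.
    by move=> y; apply: (bij_inj eps_bij); rewrite linearZ /= !eps'K.
  apply/asboolP; split=> [f g|c f].
    by rewrite /pi raddfD eps'D dual_funD.
  by rewrite /pi linearZ eps'Z dual_funZ.
have [a aP] := regular_reflexive (Sub _ PhiP : dual I).
have qa0 : bker_pred q a.
  apply/eqP/trace_separates => f ftr; rewrite -aP.
  rewrite -[LHS]/(h (eps' (pi f))).
  have -> : pi f = 0.
    rewrite -(raddf0 (quotm_pi (trace_submod_closed (ldual_obj L) I))).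
    by apply/quotm_piE; rewrite subr0.
  have -> : eps' 0 = 0 by apply: (bij_inj eps_bij); rewrite eps'K raddf0.
  exact: dual_fun0.
exists (Sub a qa0); apply: dualP => y; rewrite kernel_formE.
rewrite -[eps I y]quotm_reprK quot_ev_pi -[LHS]aP.
by rewrite -[LHS]/(h (eps' (pi _))) /pi quotm_reprK epsK.
Qed.

Lemma kernel_form_bij : bijective kernel_form.
Proof.
have /choice[g gK] := kernel_form_surj; exists g => // j.
apply/subr0_eq/kernel_form_inj; apply/eqP.
by rewrite raddfB /= gK subrr.
Qed.

(** By naturality of [eps] at the dual of right multiplication by [a], both sides evaluate a
    representative at [j a]. *)
Lemma kernel_form_ract (j : bker q) (a : A) :
  kernel_form (ract j a) =
  fmap (dual_conj G)
    (orbit_map (a : A^o) : {linear regular_obj A -> regular_obj A})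
    (kernel_form j).
Proof.
apply: dualP => y; rewrite [RHS]dual_mapE !kernel_formE.
set om := ldual_map _; have /= -> := eps_nat om y.
rewrite -[eps I y]quotm_reprK quotm_map_funE !quot_ev_pi.
by [].
Qed.

End SimpleKernel.

(** * Assembly of the isomorphism *)

Theorem proposition10 (k : closedFieldType) (A : falgType k)
    (n : nat) (L : 'I_n -> fgmod A) (L_simple : simple_list L)
    (p : forall j : 'I_n, bimod_hom A^o (simple_bimod (L j) (L j)))
    (p_exact : radical_sequence p)
    (i : 'I_n) (G : functor A^c A^c) (G_i : left_exact_projection L i G) :
  nat_iso (dual_projection p i) (dual_conj G).
Proof.
have [simpleL _ _] := L_simple; have [L_neq0 _] := simpleL i.
have q_surj (y : simple_bimod (L i) (L i)) : exists a, p i a = y.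
  (* Prescribe [y] in the component [i] and 0 in the others. *)
  have [a aP] := p_exact.1
    (dfwith (T := fun j => simple_bimod (L j) (L j)) (fun=> 0) y).
  by exists a; rewrite aP dfwith_in.
have [G_lexact [eps [eps_bij eps_nat]]] := G_i.
(* Injectivity of [D A] is what makes [eps] bijective and natural there. *)
have I_inj := @ldual_regular_injective k A.
apply: (@eilenberg_watts A A (dual_conj G) (bker (p i)) (@lkernel_fin_gen k A)
  (bker_fin_gen (p i)) (dual_conj_right_exact G_lexact)
  (kernel_form q_surj L_neq0 eps)).
- exact: kernel_form_bij (eps_bij _ I_inj).
- by apply: kernel_form_ract => f; exact: eps_nat.
Qed.
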